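(* Let $n\ge1$ and let $A$ be an integer with $0\le A\le\binom{n+1}{2}$. Let $\Theta^{\min}_n(A)$ and $\Theta^{\max}_n(A)$ denote the minimal, respectively maximal, possible class of nilpotence of an ad-nilpotent ideal in $\mathcal I^n$ whose dimension is $A$. Then $$\Theta^{\min}_n(A)=\min\left\{k:\ \binom{n+1}{2}-(n+1)\left\lfloor\frac{n+1}{k+1}\right\rfloor+(k+1)\binom{\lfloor\frac{n+1}{k+1}\rfloor+1}{2}\ge A\right\},$$ where $k$ ranges over nonnegative integers, and $$\Theta^{\max}_n(A)=\left\lfloor n+\tfrac32-\tfrac12\sqrt{4n^2+4n+9-8A}\right\rfloor .$$
   Context: Let $\mathfrak g=sl(n+1,\mathbb C)$ with a fixed Cartan subalgebra $\mathfrak h$, positive roots $\Delta^+$, root spaces $\mathfrak g_\alpha$, and Borel subalgebra $\mathfrak b=\mathfrak h\oplus\bigoplus_{\alpha\in\Delta^+}\mathfrak g_\alpha$. $\mathcal I^n$ is the set of ad-nilpotent ideals of $\mathfrak b$, i.e. ideals of $\mathfrak b$ consisting of ad-nilpotent elements (their dimensions lie between $0$ and $\binom{n+1}{2}$). For $\mathfrak i\in\mathcal I^n$ put $\mathfrak i^1=\mathfrak i$, $\mathfrak i^{m}=[\mathfrak i^{m-1},\mathfrak i]$. The class of nilpotence of $\mathfrak i$ is the smallest $m\ge0$ with $\mathfrak i^{m+1}=0$ (so the zero ideal has class $0$, and Abelian ideals are exactly those of class at most $1$). *)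

(* Defs.v *)
From HB Require Import structures.
From mathcomp Require Import all_boot all_order all_algebra.
From mathcomp Require Import complex.
From mathcomp Require Import reals.
Set Implicit Arguments.
Unset Strict Implicit.
Unset Printing Implicit Defensive.
Import Order.TTheory GRing.Theory Num.Theory.
Import passmx.
Local Open Scope ring_scope.

Section LieAlgebra.
Variables (F : fieldType) (n : nat).

Local Notation gl := 'M[F]_n.+1.
Implicit Types (x y : gl) (U V W h b i : {vspace gl}).

Definition lie x y : gl := x *m y - y *m x.

Fact lie_is_linear x : linear (lie x).
Proof.
move=> a y z; rewrite /lie mulmxDr mulmxDl -scalemxAr -scalemxAl.
by rewrite scalerBr opprD addrACA.
Qed.
HB.instance Definition _ x :=
  GRing.isLinear.Build F gl gl *:%R (lie x) (lie_is_linear x).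

Definition ad x : 'End(gl) := linfun (lie x).

Lemma adE x y : ad x y = lie x y.
Proof. by rewrite lfunE. Qed.

Definition sl : {vspace gl} := lker (linfun (mxtrace : gl -> F^o)).

Lemma mem_sl x : (x \in sl) = (\tr x == 0).
Proof. by rewrite memv_ker lfunE. Qed.

(* [U, V] is the span of all brackets [u, v] with u in U and v in V; by
   bilinearity bases suffice, see lieprod_subP. *)
Definition lieprod U V : {vspace gl} :=
  <<[seq lie u v | u <- vbasis U, v <- vbasis V]>>%VS.

Lemma lieprod_subP U V W :
  reflect (forall u v, u \in U -> v \in V -> lie u v \in W)
          (lieprod U V <= W)%VS.
Proof.
apply: (iffP span_subvP) => [sW u v uU vV | sW _ /allpairsP[[u v] /= [uU vV ->]]];
  last by apply: sW; apply: vbasis_mem.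
rewrite (coord_vbasis vV) linear_sum rpred_sum // => k _ /=.
rewrite linearZ rpredZ //= (coord_vbasis uU).
set w := (vbasis V)`_k.
have -> : lie (\sum_i coord (vbasis U) i u *: (vbasis U)`_i) w =
  - \sum_i coord (vbasis U) i u *: lie w (vbasis U)`_i.
  have -> (t : gl) : lie t w = - lie w t by rewrite /lie opprB.
  by rewrite linear_sum; congr (- _); apply: eq_bigr => j _; rewrite linearZ.
rewrite rpredN rpred_sum // => j _; rewrite rpredZ //.
have -> : lie w (vbasis U)`_j = - lie (vbasis U)`_j w by rewrite /lie opprB.
rewrite rpredN; apply: sW; apply/allpairsP; exists ((vbasis U)`_j, w) => /=.
by split=> //; apply: mem_nth; rewrite size_tuple.
Qed.

Definition abelian U : Prop := forall x y, x \in U -> y \in U -> lie x y = 0.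

(* sl has a basis of eigenvectors of ad x. *)
Definition ad_semisimple x : Prop :=
  exists s : seq F, (sl <= \sum_(c <- s) (sl :&: leigenspace (ad x) c))%VS.

Definition ad_nilpotent x : Prop :=
  exists m, forall y, y \in sl -> iter m (lie x) y = 0.

(* For a semisimple Lie algebra, a Cartan subalgebra is a maximal Abelian
   subalgebra consisting of ad-semisimple elements. *)
Record cartan h : Prop := Cartan {
  cartan_sub : (h <= sl)%VS;
  cartan_abelian : abelian h;
  cartan_max : forall k : {vspace gl},
    (k <= sl)%VS -> abelian k -> (h <= k)%VS -> k = h;
  cartan_semisimple : forall x, x \in h -> ad_semisimple x }.

Definition dual h := 'Hom(subvs_of h, F^o).

Definition root_space h (a : dual h) : {vspace gl} :=
  (sl :&: \bigcap_(H <- vbasis {:subvs_of h})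
            leigenspace (ad (vsval H)) (a H))%VS.

Lemma root_spaceP h (a : dual h) x :
  reflect (x \in sl /\ forall H : subvs_of h, lie (vsval H) x = a H *: x)
          (x \in root_space a).
Proof.
have eigP y c : (x \in leigenspace (ad y) c) = (lie y x == c *: x).
  by rewrite memv_ker !lfun_simp subr_eq0.
rewrite memv_cap; apply: (iffP andP) => -[xsl xP]; split=> //.
  have {}xP H : H \in vbasis {:subvs_of h} -> lie (vsval H) x = a H *: x.
    move=> Hin; apply/eqP; rewrite -eigP; move: xP; rewrite (big_rem H) //=.
    by rewrite memv_cap => /andP[].
  have lieN (y z : gl) : lie y z = - lie z y by rewrite /lie opprB.
  move=> H; rewrite (coord_vbasis (memvf H)) [vsval _]linear_sum lieN.
  rewrite linear_sum [a _]linear_sum scaler_suml -sumrN; apply: eq_bigr => k _ /=.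
  rewrite !linearZ /= -lieN xP ?scalerA //.
  by apply: mem_nth; rewrite size_tuple.
elim/big_ind: _ => [|U V xU xV|H _]; [exact: memvf|by rewrite memv_cap xU|].
by rewrite eigP xP.
Qed.

Definition is_root h (a : dual h) : bool := (a != 0) && (root_space a != 0%VS).

(* A positive system D, given by an enumeration of its elements: a set of roots
   containing exactly one of a and - a for every root a, and all the roots that
   are sums of two of its elements. *)
Record positive_system h (D : seq (dual h)) : Prop := PositiveSystem {
  possys_root : forall a, a \in D -> is_root a;
  possys_opp : forall a, is_root a -> (a \in D) = (- a \notin D);
  possys_add : forall a a', a \in D -> a' \in D -> is_root (a + a') ->
    a + a' \in D }.

Definition borel h (D : seq (dual h)) : {vspace gl} :=
  (h + \sum_(a <- D) root_space a)%VS.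

Definition lie_ideal b i : Prop := (i <= b)%VS /\ (lieprod b i <= i)%VS.

Definition adnilpotent_ideal b i : Prop :=
  lie_ideal b i /\ (forall x, x \in i -> ad_nilpotent x).

(* ideal_power i m is i^{m+1}: i^1 = i and i^{m+1} = [i^m, i]. *)
Fixpoint ideal_power i (m : nat) : {vspace gl} :=
  if m is m'.+1 then lieprod (ideal_power i m') i else i.

End LieAlgebra.

Definition is_least (P : nat -> Prop) (k : nat) : Prop :=
  P k /\ forall j, P j -> (k <= j)%N.

Definition is_greatest (P : nat -> Prop) (k : nat) : Prop :=
  P k /\ forall j, P j -> (j <= k)%N.

Definition nilpotence_class (F : fieldType) n (i : {vspace 'M[F]_n.+1}) :
    nat -> Prop :=
  is_least (fun m => ideal_power i m = 0%VS).

Definition classes_of_dim (F : fieldType) n (b : {vspace 'M[F]_n.+1}) (A : nat) :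
    nat -> Prop :=
  fun c => exists i : {vspace 'M[F]_n.+1},
    [/\ adnilpotent_ideal b i, \dim i = A & nilpotence_class i c].

(* Computed in int, as subtraction on nat is truncated. *)
Definition min_bound (n k : nat) : int :=
  let q := (n.+1 %/ k.+1)%N in
  'C(n.+1, 2)%:Z - n.+1%:Z * q%:Z + k.+1%:Z * 'C(q.+1, 2)%:Z.

(* Main.v *)
(* The Cartan subalgebra is simultaneously diagonalizable, so in a suitable
   basis it consists of the traceless diagonal matrices, the roots are the
   e_i - e_j, and a positive system is a total order on the indices; after
   sorting them the Borel subalgebra is the algebra of upper triangular
   traceless matrices. Its ad-nilpotent ideals are spanned by matrix units, and
   correspond to nondecreasing functions f with a < f a: the unit E_(a, b) lies
   in the ideal iff f a <= b. Powers of the ideal correspond to iterates of f,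
   so the class is the least m such that f^(m+1) 0 exceeds n, while the
   dimension is the number of pairs with f a <= b. If the class is at most k,
   the orbit of 0 cuts the indices into k + 1 blocks with no pair of the ideal
   inside a block, and the dimension is largest for balanced blocks (Turan).
   If the class is at least c, the dimension is at least that of the ideal
   generated by the chain 0, 1, ..., c - 1, n. Adding or removing one corner at
   a time reaches all intermediate dimensions. *)
From HB Require Import structures.
Require Import Defs.
From mathcomp Require Import all_boot all_order all_algebra.
From mathcomp Require Import fingroup perm.
From mathcomp Require Import complex.
From mathcomp Require Import reals.
From mathcomp Require Import zify lra.
Import Order.TTheory GRing.Theory Num.Theory.
Local Open Scope ring_scope.

Set Implicit Arguments.
Unset Strict Implicit.

(** * Staircases *)

Section Staircases.
Local Open Scope nat_scope.
Implicit Types (f g : nat -> nat) (a b c k m t N A : nat).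

(* f encodes the up-closed set of positions (a, b) with f a <= b, all of
   them strictly above the diagonal. *)
Definition staircase f := {homo f : a b / a <= b} /\ forall a, a < f a.

Definition area f N := \sum_(a < N) (N - f a).

Lemma iter_homo f k : {homo f : a b / a <= b} ->
  {homo iter k f : a b / a <= b}.
Proof. by move=> fM a b le_ab; elim: k => //= k; apply: fM. Qed.

Lemma leq_iter f g k a : {homo g : a b / a <= b} -> (forall a, f a <= g a) ->
  iter k f a <= iter k g a.
Proof.
by move=> gM le_fg; elim: k => //= k IHk; apply: leq_trans (le_fg _) (gM _ _ IHk).
Qed.

Lemma ltn_iter f k a : (forall a, a < f a) -> k + a <= iter k f a.
Proof. by move=> ltf; elim: k => //= k; rewrite addSn => /leq_ltn_trans; apply. Qed.

Lemma iter_leq f k m a : (forall a, a < f a) -> k <= m -> iter k f a <= iter m f a.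
Proof.
move=> ltf /subnKC <-; rewrite addnC iterD.
exact: leq_trans (leq_addl _ _) (ltn_iter _ _ ltf).
Qed.

(** * Changing the area one corner at a time *)

Lemma area_update f N a v : a < N ->
  area (fun b => if b == a then v else f b) N + (N - f a) = area f N + (N - v).
Proof.
move=> aN; rewrite /area (bigD1 (Ordinal aN)) //= eqxx.
rewrite [in RHS](bigD1 (Ordinal aN)) //=.
under eq_bigr => b /negPf b_a.
  rewrite -val_eqE /= in b_a; rewrite b_a.
over.
by lia.
Qed.

Lemma sum_gap N : \sum_(a < N) (N - a.+1) = 'C(N, 2).
Proof.
rewrite (reindex_inj rev_ord_inj) /= -triangular_sum big_mkord.
by apply: eq_bigr => i _; have := ltn_ord i; lia.
Qed.

(** Induction on the excess area. Raising [f] by one in the last row that meets the first [N]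
    columns removes one corner. *)
Lemma area_shrink f N A : staircase f -> A <= area f N ->
  exists g, [/\ staircase g, forall a, f a <= g a & area g N = A].
Proof.
have [k] := ubnP (area f N - A); elim: k f => // k IHk f ltk [fM ltf] leA.
have [->|neA] := eqVneq A (area f N); first by exists f.
have [a /andP[aN faN] a_max] : {a | (a < N) && (f a < N) &
    forall b, (b < N) && (f b < N) -> b <= a}.
  have exP : exists a, (a < N) && (f a < N).
    have: 0 < area f N by lia.
    rewrite lt0n sum_nat_eq0 negb_forall => /existsP[a /= ?].
    by exists a; rewrite ltn_ord /=; lia.
  have ubP b : (b < N) && (f b < N) -> b <= N by case/andP => /ltnW.
  by case: (ex_maxnP exP ubP) => a ? ?; exists a.
pose g b := if b == a then (f a).+1 else f b.
have gE := @area_update f N a (f a).+1 aN; rewrite -/g in gE.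
have le_fg b : f b <= g b by rewrite /g; case: eqP => // ->.
have [|||h [hS le_gh hA]] := IHk g.
- by lia.
- split=> [b c le_bc|b]; last exact: leq_trans (le_fg b).
  rewrite /g; have [ba|ba] := eqVneq b a; have [ca|ca] := eqVneq c a; subst=> //.
  + have ltac : a < c by rewrite ltn_neqAle eq_sym ca.
    have [fcN|//] := ltnP (f c) N; last exact: leq_trans.
    (* A later row with [f c < N] would contradict the choice of [a] as the last one, so
       monotonicity survives. *)
    have := a_max c; rewrite fcN (leq_trans _ fcN) ?ltnS ?(ltnW (ltf _)) //=.
    by move=> /(_ isT); rewrite leqNgt ltac.
  + exact: leq_trans (fM _ _ le_bc) _.
  + exact: fM.
- by lia.
by exists h; split=> // b; apply: leq_trans (le_fg b) (le_gh b).
Qed.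

(** Induction on the missing area. The row to enlarge is the first one not yet full: all rows above
    it satisfy [f b = b.+1], so lowering its value keeps [f] monotone. *)
Lemma area_grow f N A : staircase f -> area f N <= A <= 'C(N, 2) ->
  exists g, [/\ staircase g, forall a, g a <= f a & area g N = A].
Proof.
have [k] := ubnP (A - area f N); elim: k f => // k IHk f ltk [fM ltf] leA.
have [->|neA] := eqVneq A (area f N); first by exists f.
have [a /andP[aN faN] a_min] : {a | (a.+1 < N) && (a.+1 < f a) &
    forall b, (b.+1 < N) && (b.+1 < f b) -> a <= b}.
  have exP : exists a, (a.+1 < N) && (a.+1 < f a).
    have [/existsP[a ?]|] := boolP [exists a : 'I_N, (a.+1 < N) && (a.+1 < f a)].
      by exists a.
    rewrite negb_exists => /forallP noa.
    suff: area f N = 'C(N, 2) by lia.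
    rewrite -sum_gap; apply: eq_bigr => a _; have := noa a.
    by have := ltn_ord a; have := ltf a; lia.
  by case: (ex_minnP exP) => a ? ?; exists a.
(* The truncation at [N] matters when [f a] exceeds [N]: the row is then empty and must receive the
   position in column [N.-1]. *)
pose v := (minn (f a) N).-1; pose g b := if b == a then v else f b.
have gE := @area_update f N a v (ltnW aN); rewrite -/g in gE.
have le_gf b : g b <= f b by rewrite /g /v; case: eqP => // ->; lia.
have [|||h [hS le_hg hA]] := IHk g.
- by rewrite /v in gE; lia.
- split=> [b c le_bc|b].
    rewrite /g; have [ba|ba] := eqVneq b a; have [ca|ca] := eqVneq c a; subst=> //.
    + by have := fM _ _ le_bc; rewrite /v; lia.
    + have ltba : b < a by rewrite ltn_neqAle ba.
      by have := a_min b; have := ltf b; rewrite /v; lia.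
    + exact: fM.
  by rewrite /g /v; case: eqP => [->|_]; [lia|apply: ltf].
- by rewrite /v in gE; lia.
by exists h; split=> // b; apply: leq_trans (le_hg b) (le_gf b).
Qed.

(** * Short orbits of 0: an upper bound on the area, and its sharpness *)

Lemma mul2_bin2 s : 2 * 'C(s.+1, 2) = s.+1 * s.
Proof. by elim: s => // s IHs; rewrite binS bin1; nia. Qed.

(* The tangent line of the convex sequence 'C(s, 2) between q and q.+1. *)
Lemma bin2_tangent q s : q * s <= 'C(s, 2) + 'C(q.+1, 2).
Proof.
have := mul2_bin2 q; case: s => [|s]; first by lia.
by have := mul2_bin2 s; have [/subnKC <-|/subnKC <-] := leqP q s; nia.
Qed.

Lemma area_gap f N : (forall a, a < f a) ->
  area f N + \sum_(a < N) (minn (f a) N - a.+1) = 'C(N, 2).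
Proof.
move=> ltf; rewrite -big_split /= -sum_gap; apply: eq_bigr => a _.
by have := ltn_ord a; have := ltf a; lia.
Qed.

Lemma sum_ord_split (F : nat -> nat) t N : t <= N ->
  \sum_(a < N) F a = \sum_(a < t) F a + \sum_(i < N - t) F (t + i).
Proof.
move=> le_tN; rewrite -2!(big_mkord xpredT F) (@big_cat_nat _ _ _ t) //=.
congr (_ + _); rewrite -{1}[t]add0n big_addn big_mkord.
by apply: eq_bigr => i _; rewrite addnC.
Qed.

(** The sum counts the pairs above the diagonal that the staircase misses. The orbit of 0 cuts the
    indices into at most [m] blocks, all pairs inside a block are missed, and each block size is
    bounded by the tangent line at [q]. The induction removes the last block. *)
Lemma gap_ge f q m N : staircase f -> N <= iter m f 0 ->
  q * N <= \sum_(a < N) (minn (f a) N - a.+1) + m * 'C(q.+1, 2).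
Proof.
move=> [fM ltf]; elim: m N => [|m IHm] N; first by case: N; rewrite ?muln0.
have [le_Nt _|lt_tN leN] := leqP N (iter m f 0).
  by apply: leq_trans (IHm N le_Nt) _; rewrite mulSn; lia.
set t := iter m f 0 in IHm lt_tN leN *.
rewrite (sum_ord_split (fun a => minn (f a) N - a.+1) (ltnW lt_tN)).
(* On the last block [f] takes values at least [f t], which is at least [N]. *)
have -> : \sum_(i < N - t) (minn (f (t + i)) N - (t + i).+1) = 'C(N - t, 2).
  rewrite -sum_gap; apply: eq_bigr => i _.
  by have /(leq_trans leN) := fM _ _ (leq_addr i t); rewrite /= -/t; lia.
have le_t : \sum_(a < t) (minn (f a) t - a.+1) <= \sum_(a < t) (minn (f a) N - a.+1).
  by apply: leq_sum => a _; lia.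
have := IHm t (leqnn t); have := bin2_tangent q (N - t); rewrite mulSn; nia.
Qed.

Lemma area_short_chains f q m N : staircase f -> N <= iter m f 0 ->
  area f N + q * N <= 'C(N, 2) + m * 'C(q.+1, 2).
Proof.
by move=> fS leN; have := gap_ge q fS leN; have := area_gap N (proj2 fS); lia.
Qed.

(** Consecutive blocks of lengths [s i] are laid out from 0, and [f] sends an index to the start of
    the next block; the missed pairs are then exactly those inside a block. *)
Lemma blocks (s : nat -> nat) : (forall i, 0 < s i) ->
  exists f, staircase f /\ forall m (T := \sum_(i < m) s i),
    [/\ iter m f 0 = T, forall a, a < T -> f a <= T &
        \sum_(a < T) (f a - a.+1) = \sum_(i < m) 'C(s i, 2)].
Proof.
move=> s_gt0; pose T m := \sum_(i < m) s i.
have TS m : T m.+1 = T m + s m by rewrite /T big_ord_recr.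
have leT m : m <= T m by elim: m => // m IHm; rewrite TS; have := s_gt0 m; lia.
have TM : {homo T : i j / i <= j}.
  by apply: homo_leq => [//|? ? ?|i]; [apply: leq_trans|rewrite TS leq_addr].
have exT a : exists i, a < T i by exists a.+1; apply: leq_trans (leT _).
(* The value at [a] is the least partial sum beyond [a]. *)
have f_ex a : {v | a < v & (exists i, v = T i) /\ forall i, a < T i -> v <= T i}.
  case: (ex_minnP (exT a)) => i lti i_min; exists (T i) => //.
  by split; [exists i|move=> j /i_min /TM].
pose f a := s2val (f_ex a).
have ltf a : a < f a := s2valP (f_ex a).
have f_le a i : a < T i -> f a <= T i by case: (s2valP' (f_ex a)) => _; apply.
have fT a : exists i, f a = T i by case: (s2valP' (f_ex a)).
have fE m a : T m <= a < T m.+1 -> f a = T m.+1.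
  case/andP=> leTa ltaT; apply/eqP; rewrite eqn_leq f_le //=.
  have [i fi] := fT a; rewrite fi TM // ltnNge; apply/negP => /TM.
  by rewrite leqNgt (leq_ltn_trans leTa) // -fi.
exists f; split.
  split=> // a b le_ab; have [i fi] := fT b.
  by rewrite fi f_le // -fi (leq_ltn_trans le_ab).
move=> m; rewrite -/(T m); split; [|by move=> a; apply: f_le|].
  elim: m => [|m IHm]; first by rewrite /T big_ord0.
  by rewrite iterS IHm (fE m) // leqnn TS -[ltnLHS]addn0 ltn_add2l s_gt0.
elim: m => [|m IHm]; first by rewrite /T !big_ord0.
have leTm : T m <= T m.+1 by apply: TM.
rewrite (sum_ord_split (fun a => f a - a.+1) leTm) IHm [RHS]big_ord_recr /=.
congr (_ + _); rewrite TS addKn -sum_gap; apply: eq_bigr => i _.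
rewrite (fE m); first by rewrite TS; lia.
by rewrite TS leq_addr ltn_add2l ltn_ord.
Qed.

(** Blocks of sizes [q] and [q.+1] only, [N %% m.+1] of them of the larger size, make the tangent
    inequality [bin2_tangent] an equality on every block. *)
Lemma area_balanced N m (q := N %/ m.+1) : exists f,
  [/\ staircase f, N <= iter m.+1 f 0 &
      'C(N, 2) + m.+1 * 'C(q.+1, 2) <= area f N + q * N].
Proof.
(* For [q = 0] some blocks would be empty; here [N <= m], and the full staircase [S] already has a
   short enough orbit. *)
have [q0|q_gt0] := posnP q.
  exists S; split; first by split.
  - apply: leq_trans (ltn_iter m.+1 0 ltnSn); rewrite addn0.
    by move/eqP: q0; rewrite /q -leqn0 leqNgt divn_gt0 // -ltnNge => /ltnW.
  - by rewrite q0 muln0 mul0n !addn0 /area sum_gap.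
have sgt0 i : 0 < q + (i < N %% m.+1) by rewrite addn_gt0 q_gt0.
have [f [fS /(_ m.+1)]] := blocks sgt0.
have sumr : \sum_(i < m.+1) (i < N %% m.+1) = N %% m.+1.
  have le_r : N %% m.+1 <= m.+1 := ltnW (ltn_pmod N (ltn0Sn m)).
  rewrite (sum_ord_split (fun i => nat_of_bool (i < N %% m.+1)) le_r).
  rewrite [X in _ + X]big1 => [|i _]; last by rewrite ltnNge leq_addr.
  under eq_bigr do rewrite ltn_ord.
  by rewrite sum1_card card_ord addn0.
have defN : m.+1 * q + N %% m.+1 = N by rewrite mulnC -divn_eq.
have -> : \sum_(i < m.+1) (q + (i < N %% m.+1)) = N.
  by rewrite big_split /= sumr sum_nat_const card_ord.
case=> iterf f_le gapE; exists f; split=> //; first by rewrite iterf.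
have : \sum_(i < m.+1) 'C(q + (i < N %% m.+1), 2) = m.+1 * 'C(q, 2) + q * (N %% m.+1).
  have -> : m.+1 * 'C(q, 2) = \sum_(i < m.+1) 'C(q, 2) by rewrite sum_nat_const card_ord.
  rewrite -{2}sumr big_distrr /= -big_split /=.
  apply: eq_bigr => i _.
  by case: (i < _); rewrite ?addn0 ?muln0 ?addn0 ?addn1 ?binS ?bin1; lia.
have gapE' : \sum_(a < N) (minn (f a) N - a.+1) = \sum_(a < N) (f a - a.+1).
  by apply: eq_bigr => a _; rewrite (minn_idPl (f_le _ _)).
have := area_gap N (proj2 fS); rewrite gapE' gapE.
have : 2 * 'C(q, 2) + q = q * q by case: (q) => // k; have := mul2_bin2 k; nia.
by rewrite binS bin1; nia.
Qed.

(** * Long orbits of 0: a lower bound on the area, and its sharpness *)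

Lemma area_row f t E : staircase f -> f t <= E -> area f E + t.+1 <= area f E.+1.
Proof.
move=> [fM ltf] leE; have ltE : t.+1 <= E := leq_trans (ltf t) leE.
rewrite /area big_ord_recr /= (eqP (ltf E : E.+1 - f E == 0)) addn0.
have -> : \sum_(a < E) (E.+1 - f a) = \sum_(a < E) ((E - f a) + (f a <= E)).
  by apply: eq_bigr => a _; case: leqP; lia.
rewrite big_split /= leq_add2l (sum_ord_split (fun a => nat_of_bool (f a <= E)) ltE).
rewrite -[leqLHS]addn0 leq_add // -[leqLHS]card_ord -sum1_card leq_sum // => a _.
by rewrite (leq_trans (fM a t _) leE) // -ltnS ltn_ord.
Qed.

Lemma area_rows f t E : staircase f -> f t <= E ->
  area f (f t) + t.+1 * (E - f t) <= area f E.
Proof.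
move=> fS; elim: E => [|E IHE]; first by rewrite leqn0 => /eqP->; rewrite muln0 addn0.
rewrite leq_eqVlt => /predU1P[->|leE]; first by rewrite subnn muln0 addn0.
have := IHE leE; have := area_row fS leE; rewrite subSn // mulnS; lia.
Qed.

(** Each column from [f u] on contains the rows [0] to [u]. Summing over the columns between
    successive orbit points [u] gives the bound; [e] is general so that the induction can stop just
    before the next orbit point. *)
Lemma area_chain f c e (t := iter c.+1 f 0) : staircase f -> t <= e ->
  2 * c * t + 2 * c.+1 + 2 * c.+1 * (e - t) <= 2 * area f e.+1 + c.+1 * c.
Proof.
move=> fS; rewrite /t; elim: c e {t} => [|c IHc] e /= le_te.
  have := area_rows fS (leqW le_te : f 0 <= e.+1); nia.
rewrite -[f (iter c f 0)]/(iter c.+1 f 0) in le_te *.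
set u := iter c.+1 f 0 in IHc le_te *.
have := area_rows fS (leqW le_te : f u <= e.+1).
have le_cu : c < u by have := @ltn_iter f c.+1 0 (proj2 fS); rewrite addn0.
have ltu := proj2 fS u; have := IHc (f u).-1; rewrite (ltn_predK ltu).
have -> : u <= (f u).-1 by rewrite -ltnS (ltn_predK ltu).
have [x defT] : exists x, f u = u.+1 + x by exists (f u - u.+1); rewrite subnKC.
have [y defe] : exists y, e = f u + y by exists (e - f u); rewrite subnKC.
(* Only [y] of the [y.+1] new columns are estimated by [c < u]. The remaining one keeps its count
   [u.+1], which raises the coefficient of [u] from [c] to [c.+1]. *)
have : c.+2 * y <= u.+1 * y by rewrite leq_mul2r ltnS le_cu orbT.
have -> : e.+1 - f u = y.+1 by lia.
have -> : e - f u = y by lia.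
have -> : (f u).-1 - u = x by lia.
by rewrite defT => cu_y /(_ isT); lia.
Qed.

(* Subtraction-free form of n (c - 1) + c (3 - c) / 2 <= area f n.+1. *)
Lemma area_long_chain f c n : staircase f -> iter c f 0 <= n ->
  2 * n * c + 3 * c <= 2 * area f n.+1 + c * c + 2 * n.
Proof.
case: c => [|c] fS le_n; first by lia.
have := area_chain fS le_n; nia.
Qed.

Lemma area_long_chain_ex n c A : c <= n -> A <= 'C(n.+1, 2) ->
  2 * n * c + 3 * c <= 2 * A + c * c + 2 * n -> exists f,
  [/\ staircase f, iter c f 0 <= n & area f n.+1 = A].
Proof.
(* For [c = 0] the orbit condition is empty, and any area is reached by shrinking the full
   staircase. *)
case: c => [|c] le_cn leA le_low.
  have [||f [fS _ fA]] := @area_shrink S n.+1 A; first by split.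
    by rewrite /area sum_gap.
  by exists f.
(* The staircase generated by the chain [0, 1, ..., c, n]; rows after [c] are empty within the first
   [n.+1] columns. Enlarging it only lowers the iterates, so the orbit stays long. *)
pose f a := if a < c then a.+1 else if a == c then n else maxn a.+1 n.+1.
have fS : staircase f.
  split=> [a b|a]; rewrite /f; last by case: (ltnP a c); case: (eqVneq a c); lia.
  by case: (ltnP a c); case: (ltnP b c); case: (eqVneq a c); case: (eqVneq b c); lia.
have iterf i : i <= c -> iter i f 0 = i.
  by elim: i => // i IHi lt_ic; rewrite iterS IHi ?(ltnW lt_ic) // /f lt_ic.
have f_n : iter c.+1 f 0 = n by rewrite iterS iterf // /f ltnn eqxx.
have areaf : 2 * area f n.+1 + c.+1 * c = 2 * n * c + 2 * c.+1.
  rewrite /area (sum_ord_split (fun a => n.+1 - f a) (leqW (ltnW le_cn))).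
  have -> : \sum_(i < n.+1 - c) (n.+1 - f (c + i)) = 1.
    rewrite subSn ?(ltnW le_cn) // big_ord_recl addn0 {1}/f ltnn eqxx subSnn.
    rewrite big1 // => i _; rewrite /f lift0.
    by case: (ltnP (c + i.+1)); case: (eqVneq (c + i.+1) c); lia.
  have: 2 * \sum_(a < c) (n.+1 - f a) + c.+1 * c = 2 * n * c + 2 * c; last by lia.
  rewrite (eq_bigr (fun a : 'I_c => n - a)) => [|a _]; last by rewrite /f ltn_ord.
  have := ltnW le_cn; elim: (c) => [|k IHk] le_kn; first by rewrite big_ord0; lia.
  by have := IHk (ltnW le_kn); rewrite big_ord_recr /=; nia.
have [|g [gS le_gf gA]] := @area_grow f n.+1 A fS; first by rewrite leA andbT; nia.
by exists g; split=> //; rewrite -f_n; apply: leq_iter; case: fS.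
Qed.

End Staircases.

(** * Extremal classes of staircases of a given area *)

Section Extremes.
Local Open Scope nat_scope.
Variables (n A : nat).

Definition staircase_class c := exists f,
  [/\ staircase f, area f n.+1 = A & is_least (fun m => n < iter m.+1 f 0) c].

Lemma min_boundE j (q := n.+1 %/ j.+1) :
  (A%:Z <= min_bound n j)%R = (A + q * n.+1 <= 'C(n.+1, 2) + j.+1 * 'C(q.+1, 2)).
Proof. by rewrite /min_bound -/q; apply/idP/idP; lia. Qed.

Lemma staircase_class_ex f : staircase f ->
  exists c, is_least (fun m => n < iter m.+1 f 0) c.
Proof.
move=> [_ ltf]; have exc : exists m, n < iter m.+1 f 0.
  by exists n; have := @ltn_iter f n.+1 0 ltf; rewrite addn0.
by case: (ex_minnP exc) => c ? ?; exists c.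
Qed.

(** The bound for short orbits shows that every class satisfies the inequality. Conversely, a
    balanced staircase shrunk to area [A] has larger iterates, hence class at most [k]. *)
Lemma least_staircase_class : A <= 'C(n.+1, 2) -> exists k,
  is_least staircase_class k /\ is_least (fun j => A%:Z <= min_bound n j)%R k.
Proof.
move=> leA; have exk : exists k, (A%:Z <= min_bound n k)%R.
  by exists n; rewrite min_boundE divnn binn; lia.
have [k lek k_min] := ex_minnP exk; exists k; split; last by split.
have upper c : staircase_class c -> k <= c.
  case=> f [fS fA [ltn_f _]]; apply: k_min; rewrite min_boundE -fA.
  exact: area_short_chains.
split=> //; have [f [fS le_iter le_area]] := area_balanced n.+1 k.
have [|g [gS le_fg gA]] := @area_shrink f n.+1 A fS.
  by move: lek; rewrite min_boundE; lia.
have [c cP] := staircase_class_ex gS.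
have Ac : staircase_class c by exists g.
suff -> : k = c by [].
apply/eqP; rewrite eqn_leq upper //=; case: cP => _; apply.
by apply: leq_trans le_iter _; apply: leq_iter => //; case: gS.
Qed.

Lemma greatest_staircase_class : A <= 'C(n.+1, 2) -> exists k,
  [/\ is_greatest staircase_class k, k <= n,
      2 * n * k + 3 * k <= 2 * A + k * k + 2 * n &
      2 * A + k.+1 * k.+1 + 2 * n < 2 * n * k.+1 + 3 * k.+1].
Proof.
move=> leA; pose P k := (k <= n) && (2 * n * k + 3 * k <= 2 * A + k * k + 2 * n).
have exP : exists k, P k by exists 0; rewrite /P; lia.
have ubP k : P k -> k <= n by case/andP.
have [k /andP[le_kn lowk] k_max] := ex_maxnP exP ubP.
have lower c : staircase_class c -> c <= k.
  case=> f [fS fA [_ c_min]].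
  (* Minimality of [c] says that [c.-1] fails; for [c = 0] the iterate is 0. *)
  have le_c : iter c f 0 <= n.
    by case: c c_min => // c c_min; rewrite leqNgt; apply/negP => /c_min; rewrite ltnn.
  apply: k_max; rewrite /P -fA area_long_chain // andbT.
  by apply: leq_trans le_c; have := @ltn_iter f c 0 (proj2 fS); rewrite addn0.
have [f [fS le_iter fA]] := area_long_chain_ex le_kn leA lowk.
have [c cP] := staircase_class_ex fS; exists k; split=> //; last first.
  (* For [k < n] maximality gives the strict inequality; for [k = n] it follows from the bound on
     [A]. *)
  have := k_max k.+1; have := mul2_bin2 n; rewrite ltnn /P.
  by case: (ltnP k n) => [_|]; nia.
split=> //; suff -> : k = c by exists f.
have ck : c <= k by apply: lower; exists f.
apply/eqP; rewrite eqn_leq ck andbT leqNgt; apply/negP => lt_ck.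
case: cP => + _; rewrite ltnNge (leq_trans _ le_iter) //.
by apply: iter_leq => //; case: fS.
Qed.

(** With [s] the square root, the floor condition reads [2 n + 1 - 2 k < s <= 2 n + 3 - 2 k]. As
    [k <= n], the outer terms are nonnegative, and squaring yields the two quadratic
    inequalities. *)
Lemma floor_class (R : realType) k : A <= 'C(n.+1, 2) -> k <= n ->
  2 * n * k + 3 * k <= 2 * A + k * k + 2 * n ->
  2 * A + k.+1 * k.+1 + 2 * n < 2 * n * k.+1 + 3 * k.+1 ->
  (k%:Z = Num.floor (n%:R + 3%:R / 2%:R
           - 2%:R^-1 * Num.sqrt (4%:R * n%:R ^+ 2 + 4%:R * n%:R + 9%:R
                                 - 8%:R * A%:R) : R))%R.
Proof.
move=> leA le_kn lo hi; apply/esym/floor_def.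
have {}leA : (2 * A%:R <= (n%:R + 1) * n%:R :> R)%R.
  by rewrite natr1 -!natrM ler_nat -mul2_bin2 leq_mul2l.
have {}lo : (2 * n%:R * k%:R + 3 * k%:R <= 2 * A%:R + k%:R * k%:R + 2 * n%:R :> R)%R.
  by rewrite -!natrM -!natrD ler_nat.
have {}hi : (2 * A%:R + (k%:R + 1) * (k%:R + 1) + 2 * n%:R
    < 2 * n%:R * (k%:R + 1) + 3 * (k%:R + 1) :> R)%R.
  by rewrite natr1 -!natrM -!natrD ltr_nat.
have {}le_kn : (k%:R <= n%:R :> R)%R by rewrite ler_nat.
rewrite intrD -!pmulrn.
move: (n%:R)%R (k%:R)%R (A%:R)%R (ler0n R k) leA lo hi le_kn.
move=> n' k' a k0 leA lo hi le_kn.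
set d := (4%:R * _ + _ + _ - _)%R.
have d0 : (0 <= d)%R by rewrite /d; nra.
have s0 := sqrtr_ge0 d; have s2 := sqr_sqrtr d0.
set s := Num.sqrt d in s0 s2 *.
have dE : (d = 4%:R * n' ^+ 2 + 4%:R * n' + 9%:R - 8%:R * a)%R by [].
have le_s : (s <= 2 * n' + 3 - 2 * k')%R.
  rewrite -(@ler_pXn2r _ 2) ?nnegrE //; last by lra.
  by rewrite s2 dE; lra.
have lt_s : (2 * n' + 1 - 2 * k' < s)%R.
  rewrite -(@ltr_pXn2r _ 2) ?nnegrE //; last by lra.
  by rewrite s2 dE; lra.
by apply/andP; split; lra.
Qed.
End Extremes.

(** * Ideals of upper triangular matrices *)

Section Conjugation.
Variables (F : fieldType) (n : nat) (Q : 'M[F]_n.+1).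
Hypothesis Q_unit : Q \in unitmx.
Local Notation gl := 'M[F]_n.+1.
Implicit Types (x y : gl) (a b : 'I_n.+1) (g : nat -> nat) (m : nat).

(** The matrix, in the basis formed by the rows of [Q], of the map [v |-> v *m x] on row vectors. *)
Definition co x : gl := Q *m x *m invmx Q.

HB.instance Definition _ :=
  GRing.Linear.copy co (mulmxr (invmx Q) \o mulmx Q).

Definition co_inv x : gl := invmx Q *m x *m Q.
Local Notation E a b := (co_inv (delta_mx a b)).

Lemma co_invK x : co (co_inv x) = x.
Proof. by rewrite /co /co_inv !mulmxA mulmxV // mul1mx mulmxK. Qed.

Lemma coK x : co_inv (co x) = x.
Proof. by rewrite /co /co_inv !mulmxA mulVmx // mul1mx mulmxKV. Qed.

Lemma coM x y : co (x *m y) = co x *m co y.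
Proof. by rewrite /co !mulmxA mulmxKV. Qed.

Lemma co_lie x y : co (lie x y) = lie (co x) (co y).
Proof. by rewrite /lie linearB /= !coM. Qed.

Lemma mxtrace_co x : \tr (co x) = \tr x.
Proof. by rewrite /co mxtrace_mulC mulmxA mulVmx // mul1mx. Qed.

Lemma co_lieE x y a b : co (lie x y) a b =
  \sum_j co x a j * co y j b - \sum_j co y a j * co x j b.
Proof. by rewrite co_lie !mxE. Qed.

Lemma sum_unit x :
  x = \sum_(p : 'I_n.+1 * 'I_n.+1) co x p.1 p.2 *: E p.1 p.2.
Proof.
apply: (can_inj coK); rewrite linear_sum /= {1}[co x]matrix_sum_delta pair_bigA /=.
by apply: eq_bigr => p _; rewrite linearZ /= co_invK.
Qed.

Lemma co_lie_diag (d : 'rV[F]_n.+1) x a b :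
  co (lie (co_inv (diag_mx d)) x) a b = (d 0 a - d 0 b) * co x a b.
Proof.
rewrite co_lie co_invK /lie mul_diag_mx mul_mx_diag !mxE.
by rewrite mulrBl [X in _ - X]mulrC.
Qed.

Lemma lie_unit a b j : a != b -> lie (E a j) (E j b) = E a b.
Proof.
move=> neq_ab; apply: (can_inj coK); rewrite co_lie !co_invK /lie.
by rewrite mul_delta_mx mul_delta_mx_0 ?subr0 // eq_sym.
Qed.

Lemma lieC x y : lie x y = - lie y x.
Proof. by rewrite /lie opprB. Qed.

Definition stair_space g : {vspace gl} :=
  (\sum_(p : 'I_n.+1 * 'I_n.+1 | (g p.1 <= p.2)%N) <[E p.1 p.2]>)%VS.

Lemma mem_stair_unit g a b : (g a <= b)%N -> E a b \in stair_space g.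
Proof. by move=> le_gab; rewrite memvE (sumv_sup (a, b)). Qed.

Lemma mem_stair g x :
  reflect (forall a b, (b < g a)%N -> co x a b = 0) (x \in stair_space g).
Proof.
apply: (iffP idP) => [/memv_sumP[u uP ->] a b lt_bg|x0].
  rewrite linear_sum summxE big1 // => -[k l] /= le_gkl.
  have /vlineP[c ->] := uP (k, l) le_gkl; rewrite linearZ /= co_invK !mxE.
  case: eqP lt_bg => [->|]; last by rewrite mulr0.
  by case: eqP => [->|]; [rewrite ltnNge le_gkl|rewrite mulr0].
rewrite [x]sum_unit rpred_sum // => -[a b] _ /=; case: (ltnP b (g a)) => [/x0->|].
  by rewrite scale0r mem0v.
by move=> /mem_stair_unit; apply: rpredZ.
Qed.

Lemma dim_stair g : \dim (stair_space g) = area g n.+1.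
Proof.
have dV : directv (\sum_(p : 'I_n.+1 * 'I_n.+1 | (g p.1 <= p.2)%N) <[E p.1 p.2]>).
  apply/directv_sum_independent => u uP u0 [k l] /= le_gkl.
  have /vlineP[c defu] := uP (k, l) le_gkl.
  suff c0 : c = 0 by rewrite defu c0 scale0r.
  have /matrixP/(_ k l) := congr1 co u0; rewrite linear_sum summxE !linear0 [RHS]mxE.
  rewrite (bigD1 (k, l)) //= big1 ?addr0.
    by rewrite defu linearZ /= co_invK !mxE !eqxx mulr1.
  move=> [k' l'] /= /andP[le_gkl' neq]; have /vlineP[c' ->] := uP (k', l') le_gkl'.
  by rewrite linearZ /= co_invK !mxE -xpair_eqE eq_sym (negPf neq) mulr0.
rewrite (directvP dV) /=.
rewrite (eq_bigr (fun=> 1%N)) => [|[k l] _ /=]; last first.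
  rewrite dim_vline; case: eqP => // /(congr1 co)/matrixP/(_ k l)/eqP.
  by rewrite co_invK linear0 !mxE !eqxx oner_eq0.
rewrite -(pair_big_dep xpredT (fun a b => (g a <= b)%N) (fun _ _ => 1%N)) /=.
apply: eq_bigr => a _; rewrite sum1_card.
have [leN|ltN] := leqP n.+1 (g a).
  rewrite (eqP (leN : n.+1 - g a == 0)%N) eq_card0 // => b; rewrite !inE.
  by apply/negbTE; rewrite -ltnNge (leq_trans (ltn_ord b)).
rewrite -sum1_card big_mkcond /=.
rewrite (sum_ord_split (fun j : nat => if (g a <= j)%N then 1%N else 0%N) (ltnW ltN)).
rewrite big1 ?add0n => [|b _]; last by rewrite leqNgt ltn_ord.
by under eq_bigr do rewrite leq_addr; rewrite sum1_card card_ord.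
Qed.

(** By monotonicity, the top right unit lies in the space as soon as any unit does. *)
Lemma stair_space_eq0 g : {homo g : a b / (a <= b)%N} ->
  stair_space g = 0%VS <-> (n < g 0)%N.
Proof.
move=> gM; split=> [V0|lt_ng].
  rewrite ltnNge; apply/negP => le_gn.
  have: E 0 ord_max \in stair_space g by rewrite mem_stair_unit.
  rewrite V0 memv0 => /eqP/(congr1 co)/matrixP/(_ 0 ord_max)/eqP.
  by rewrite co_invK linear0 !mxE !eqxx oner_eq0.
apply/eqP; rewrite -subv0; apply/subvP => x /mem_stair x0; rewrite memv0.
apply/eqP/(can_inj coK)/matrixP => a b; rewrite linear0 x0 ?mxE //.
exact: leq_trans (ltn_ord b) (leq_trans lt_ng (gM _ _ (leq0n a))).
Qed.

(** A nonzero product entry at [(a, b)] passes through some [j], so [b] is at least the composite of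
    both functions at [a]. Conversely, a unit allowed by the composite is the bracket of two units
    meeting at [j = g a]. *)
Lemma lieprod_stair f m : staircase f ->
  lieprod (stair_space (iter m.+1 f)) (stair_space f) = stair_space (iter m.+2 f).
Proof.
move=> [fM ltf]; set g := iter m.+1 f.
have gM : {homo g : a b / (a <= b)%N} by apply: iter_homo.
apply/eqP; rewrite eqEsubv; apply/andP; split.
  apply/lieprod_subP => x y /mem_stair x0 /mem_stair y0; apply/mem_stair => a b lt_b.
  rewrite co_lieE !big1 ?subrr // => j _.
    have [/y0->|le_fj] := ltnP j (f a); first by rewrite mul0r.
    rewrite x0 ?mulr0 //; apply: leq_trans lt_b _.
    by rewrite iterSr gM.
  have [/x0->|le_gj] := ltnP j (g a); first by rewrite mul0r.
  by rewrite y0 ?mulr0 //; apply: leq_trans lt_b _; apply: fM.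
apply/subv_sumP => -[a b] /= le_ab.
have lt_ag : (a < g a)%N.
  by apply: leq_trans (ltn_iter m.+1 a ltf); rewrite addSn ltnS leq_addl.
have lt_gb : (g a < b)%N := leq_trans (ltf _) le_ab.
have lt_gn := ltn_trans lt_gb (ltn_ord b).
rewrite -(@lie_unit a b (Ordinal lt_gn)); last first.
  by rewrite -val_eqE /= neq_ltn (ltn_trans lt_ag lt_gb).
by rewrite -memvE; apply: (lieprod_subP _ _ _ (subvv _)); apply: mem_stair_unit.
Qed.

Lemma ideal_power_stair f m : staircase f ->
  ideal_power (stair_space f) m = stair_space (iter m.+1 f).
Proof. by move=> fS; elim: m => //= m ->; apply: lieprod_stair. Qed.

Lemma nilpotence_class_stair f c : staircase f ->
  nilpotence_class (stair_space f) c <->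
  is_least (fun m => (n < iter m.+1 f 0)%N) c.
Proof.
move=> fS; have powE m : ideal_power (stair_space f) m = 0%VS <-> (n < iter m.+1 f 0)%N.
  by rewrite ideal_power_stair //; apply: stair_space_eq0 (iter_homo m.+1 (proj1 fS)).
by split=> -[/powE Pc c_min]; split=> // j /powE/c_min.
Qed.

Lemma stair_nilpotent f x : staircase f -> x \in stair_space f -> ad_nilpotent x.
Proof.
move=> [_ ltf] /mem_stair x0; exists n.*2.+1 => y _.
have xS a b : (b <= a)%N -> co x a b = 0.
  by move=> le_ba; rewrite x0 // (leq_ltn_trans le_ba).
(* Each bracket with the strictly upper triangular [x] moves the support up by at least one
   diagonal. There are [2 n + 1] diagonals, whence the exponent. *)
suff low m a b : (b + n < a + m)%N -> co (iter m (lie x) y) a b = 0.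
  apply/(can_inj coK)/matrixP => a b; rewrite linear0 [RHS]mxE low //.
  by have := ltn_ord b; lia.
elim: m a b => [|m IHm] a b lt_ab; first by have := ltn_ord a; lia.
rewrite iterS co_lieE !big1 ?subrr // => j _.
  have [/xS->|lt_jb] := leqP b j; first by rewrite mulr0.
  by rewrite IHm ?mul0r //; lia.
have [/xS->|lt_aj] := leqP j a; first by rewrite mul0r.
by rewrite IHm ?mulr0 //; lia.
Qed.

(** * Classification of the ad-nilpotent ideals of upper triangular matrices *)

Hypothesis charF : n.+1%:R != 0 :> F.

(* E k k made traceless, which does not change the brackets. *)
Definition hdiag (k : 'I_n.+1) : gl :=
  co_inv (diag_mx (\row_j ((j == k)%:R - n.+1%:R^-1))).

Lemma mxtrace_hdiag k : \tr (hdiag k) = 0.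
Proof.
rewrite -mxtrace_co co_invK mxtrace_diag; under eq_bigr do rewrite mxE.
rewrite sumrB (bigD1 k) //= eqxx big1 => [|j /negPf->//].
by rewrite sumr_const card_ord -[_^-1 *+ _]mulr_natl mulfV // addr0 subrr.
Qed.

Variable B : {vspace gl}.
Hypothesis mem_B : forall x,
  reflect (\tr x = 0 /\ forall a b, (b < a)%N -> co x a b = 0) (x \in B).

Lemma stair_ideal f : staircase f -> adnilpotent_ideal B (stair_space f).
Proof.
move=> fS; have [fM ltf] := fS; split; last by move=> x; apply: stair_nilpotent fS.
split.
  apply/subvP => x /mem_stair x0; apply/mem_B; split.
    by rewrite -mxtrace_co /mxtrace big1 // => a _; rewrite x0.
  by move=> a b lt_ba; rewrite x0 // (ltn_trans lt_ba).
apply/lieprod_subP => x y /mem_B[_ x0] /mem_stair y0; apply/mem_stair => a b lt_b.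
rewrite co_lieE !big1 ?subrr // => j _.
  have [/y0->|le_fj] := ltnP j (f a); first by rewrite mul0r.
  by rewrite x0 ?mulr0 // (leq_trans lt_b).
have [/x0->|le_aj] := ltnP j a; first by rewrite mul0r.
by rewrite y0 ?mulr0 // (leq_trans lt_b) // fM.
Qed.

(** Iterating [lie x] on [E a b] keeps the support in rows up to [a] and columns from [b] on, and
    multiplies the entry at [(a, b)] by the difference of the two diagonal entries each time.
    Nilpotence makes a power of this difference vanish. *)
Lemma nilpotent_diag x a b : x \in B -> ad_nilpotent x -> (a < b)%N ->
  co x a a = co x b b.
Proof.
move=> /mem_B[_ x0] [m xN] lt_ab; set y := E a b.
have zP k :
    (forall i j : 'I_n.+1, (a < i)%N || (j < b)%N -> co (iter k (lie x) y) i j = 0) /\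
    co (iter k (lie x) y) a b = (co x a a - co x b b) ^+ k.
  elim: k => [|k [IH0 IHab]].
    rewrite /= co_invK !mxE !eqxx; split=> // i j ij; rewrite mxE.
    case: eqP ij => [->|//]; rewrite ltnn /= => lt_jb.
    by case: eqP lt_jb => // ->; rewrite ltnn.
  split=> [i j ij|]; rewrite iterS co_lieE.
    rewrite !big1 ?subrr // => l _.
      have [/x0->|le_lj] := ltnP j l; first by rewrite mulr0.
      rewrite IH0 ?mul0r //; case/orP: ij => [->//|lt_jb].
      by rewrite (leq_ltn_trans le_lj) ?orbT.
    have [/x0->|le_il] := ltnP l i; first by rewrite mul0r.
    rewrite IH0 ?mulr0 //; case/orP: ij => [lt_ai|->]; last by rewrite orbT.
    by rewrite (leq_trans lt_ai).
  rewrite (bigD1 a) //= big1 ?addr0 => [|j neq_ja].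
    rewrite (bigD1 b) //= big1 ?addr0 => [|j neq_jb].
      by rewrite IHab exprS mulrBl [X in _ - X]mulrC.
    have [/IH0->|le_bj] := boolP ((a < a)%N || (j < b)%N); first by rewrite mul0r.
    rewrite x0 ?mulr0 // ltn_neqAle eq_sym neq_jb /=.
    by rewrite ltnn /= -leqNgt in le_bj.
  have [/x0->|le_aj] := ltnP j a; first by rewrite mul0r.
  rewrite IH0 ?mulr0 //; rewrite ltn_neqAle le_aj andbT.
  by rewrite -val_eqE eq_sym in neq_ja; rewrite neq_ja.
have y_sl : y \in sl F n.
  rewrite mem_sl -(mxtrace_co y) co_invK /mxtrace big1 // => i _.
  rewrite mxE; case: eqP => //= ->; case: eqP => // eq_ab.
  by rewrite eq_ab ltnn in lt_ab.
have [_] := zP m; rewrite xN // linear0 mxE => /esym/eqP.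
by rewrite expf_eq0 subr_eq0 => /andP[_ /eqP].
Qed.

Lemma nilpotent_strict x a b : x \in B -> ad_nilpotent x -> (b <= a)%N ->
  co x a b = 0.
Proof.
move=> xB xN; have [tr0 x0] := mem_B x xB.
rewrite leq_eqVlt => /predU1P[/val_inj->|/x0//].
have diag c : co x c c = co x a a.
  have [lt_ca|lt_ac|/val_inj->//] := ltngtP c a.
    exact: nilpotent_diag lt_ca.
  by rewrite (nilpotent_diag _ _ lt_ac).
(* The equal diagonal entries sum to the trace, which is zero, and [n.+1] is invertible. *)
move: tr0; rewrite -mxtrace_co /mxtrace (eq_bigr (fun=> co x a a)) => [|c _ //].
by rewrite sumr_const card_ord -mulr_natl => /eqP; rewrite mulf_eq0 (negPf charF) => /eqP.
Qed.

Lemma hdiag_B k : hdiag k \in B.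
Proof.
apply/mem_B; split=> [|a b lt_ba]; first exact: mxtrace_hdiag.
by rewrite co_invK mxE -val_eqE (gtn_eqF lt_ba).
Qed.

Variable I : {vspace gl}.
Hypothesis I_ideal : adnilpotent_ideal B I.

Let bracketI x y : x \in B -> y \in I -> lie x y \in I.
Proof. by case: I_ideal => -[_ /lieprod_subP + _]; apply. Qed.

Lemma ideal_strict x a b : x \in I -> (b <= a)%N -> co x a b = 0.
Proof.
case: I_ideal => -[/subvP IB _] Inil xI; apply: nilpotent_strict; first exact: IB.
exact: Inil.
Qed.

Lemma ideal_unit x k l : x \in I -> co x k l != 0 -> E k l \in I.
Proof.
move=> xI xkl; have lt_kl : (k < l)%N.
  by rewrite ltnNge; apply: contra xkl => /(ideal_strict xI)->.
have neq_kl : k != l by rewrite -val_eqE neq_ltn lt_kl.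
(* The double bracket multiplies the entry at [(a, b)] by [((a == l) - (b == l)) * ((a == k) - (b ==
   k))]. This is -1 at [(k, l)] and [(l, k)] and 0 elsewhere, and the entry of [x] at [(l, k)]
   vanishes. *)
have: - (co x k l)^-1 *: lie (hdiag l) (lie (hdiag k) x) \in I.
  by rewrite rpredZ // !bracketI ?hdiag_B.
congr (_ \in I); apply/(can_inj coK)/matrixP => a b.
rewrite linearZ /= co_invK [LHS]mxE !co_lie_diag.
have x0 := ideal_strict xI; move: (co x) x0 xkl => X X0 Xkl.
rewrite !mxE !opprB !addrA !subrK.
have [->|nak] := eqVneq a k; have [->|nbl] := eqVneq b l;
  rewrite ?eqxx ?(negPf neq_kl) ?[l == k]eq_sym ?(negPf neq_kl) /=.
- by rewrite !subr0 sub0r mul1r mulN1r mulrNN mulVf.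
- by rewrite !(subrr, mul0r, mulr0).
- by rewrite !(subrr, mul0r, mulr0).
have [->|nal] := eqVneq a l; last by rewrite !(subrr, mul0r, mulr0).
have [->|nbk] := eqVneq b k; last by rewrite !(subrr, mul0r, mulr0).
by rewrite (X0 _ _ (ltnW lt_kl)) !mulr0.
Qed.

Lemma upper_unit_B a b : (a < b)%N -> E a b \in B.
Proof.
move=> lt_ab; apply/mem_B; split=> [|i j lt_ji]; last first.
  rewrite co_invK mxE; case: eqP lt_ji => //= ->; case: eqP => //= ->.
  by rewrite ltnNge (ltnW lt_ab).
rewrite -mxtrace_co co_invK /mxtrace big1 // => i _; rewrite mxE.
by case: eqP => //= ->; case: eqP => // ab; rewrite ab ltnn in lt_ab.
Qed.

Lemma ideal_unit_lt (k l : 'I_n.+1) : E k l \in I -> (k < l)%N.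
Proof.
move=> EI; rewrite ltnNge; apply/negP => /(ideal_strict EI)/eqP.
by rewrite co_invK mxE !eqxx oner_eq0.
Qed.

(** Bracketing with the Borel units [E a k] and [E l b] moves the row up and the column right. *)
Lemma ideal_unit_up a b (k l : 'I_n.+1) : (a <= k)%N -> (l <= b)%N ->
  E k l \in I -> E a b \in I.
Proof.
move=> le_ak le_lb EI; have lt_kl := ideal_unit_lt EI.
have {EI} EI : E a l \in I.
  move: le_ak; rewrite leq_eqVlt => /predU1P[/val_inj->//|lt_ak].
  rewrite -(@lie_unit a l k) ?bracketI ?upper_unit_B //.
  by rewrite -val_eqE neq_ltn (ltn_trans lt_ak).
move: le_lb; rewrite leq_eqVlt => /predU1P[/val_inj<-//|lt_lb].
have lt_al := ideal_unit_lt EI; rewrite -(@lie_unit a b l).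
  by rewrite lieC rpredN bracketI ?upper_unit_B.
by rewrite -val_eqE neq_ltn (ltn_trans lt_al).
Qed.

Lemma ideal_stair : exists2 f, staircase f & I = stair_space f.
Proof.
(* The first disjunct adds positions outside the matrix, so that a least column exists for every
   natural number [a], beyond [a] itself. *)
pose P (a b : nat) := ((n < b) && (a < b))%N ||
  [exists k : 'I_n.+1, exists l : 'I_n.+1,
     [&& k == a :> nat, l == b :> nat & E k l \in I]].
have P_ord (k l : 'I_n.+1) : P k l = (E k l \in I).
  rewrite /P [(n < l)%N]ltnNge -ltnS ltn_ord /=; apply/existsP/idP.
    by case=> k' /existsP[l' /and3P[/eqP/val_inj-> /eqP/val_inj->]].
  by move=> EI; exists k; apply/existsP; exists l; rewrite !eqxx.
have exP (a : nat) : exists b : nat, P a b.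
  by exists (maxn n a).+1; rewrite /P !ltnS leq_maxl leq_maxr.
pose f (a : nat) := ex_minn (exP a).
have Pf (a : nat) : P a (f a) by rewrite /f; case: ex_minnP.
have f_min (a b : nat) : P a b -> (f a <= b)%N.
  by rewrite /f; case: ex_minnP => ? ? + /=; apply.
have ltP' (a b : nat) : P a b -> (a < b)%N.
  case/orP => [/andP[]//|/existsP[k /existsP[l /and3P[/eqP<- /eqP<-]]]].
  exact: ideal_unit_lt.
have fS : staircase f.
  split=> [c d le_cd|c]; last exact/ltP'/Pf.
  apply: f_min; case/orP: (Pf d) => [/andP[ltn_f ltd]|].
    by rewrite /P ltn_f (leq_ltn_trans le_cd).
  case/existsP=> k /existsP[l /and3P[/eqP kd /eqP<- EI]].
  have lt_cn : (c < n.+1)%N by rewrite (leq_ltn_trans le_cd) // -kd.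
  rewrite (P_ord (Ordinal lt_cn) l); apply: ideal_unit_up EI => //.
  by rewrite /= kd.
exists f => //; apply/eqP; rewrite eqEsubv; apply/andP; split.
  apply/subvP => x xI; apply/mem_stair => a b lt_b; apply/eqP.
  apply: contraLR lt_b => /(ideal_unit xI) EI.
  by rewrite -leqNgt f_min // P_ord.
apply/subv_sumP => -[a b] /= le_fb; rewrite -memvE.
have := Pf a; rewrite /P => /orP[/andP[lt_nf]|].
  by rewrite ltnNge -ltnS (leq_trans _ (ltn_ord b)) // ltnS in lt_nf.
case/existsP=> k /existsP[l /and3P[/eqP/val_inj-> /eqP lE EI]].
by apply: ideal_unit_up EI => //; rewrite lE.
Qed.

End Conjugation.

Lemma classes_of_dim_staircase (F : fieldType) n (Q : 'M[F]_n.+1)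
    (B : {vspace 'M[F]_n.+1}) A c : Q \in unitmx -> n.+1%:R != 0 :> F ->
    (forall x, reflect
       (\tr x = 0 /\ forall a b : 'I_n.+1, (b < a)%N -> co Q x a b = 0) (x \in B)) ->
  classes_of_dim B A c <-> staircase_class n A c.
Proof.
move=> Qu ch mem_B; split=> [[I [Ii dI cI]]|[f [fS fA fc]]].
  have [f fS defI] := ideal_stair Qu ch mem_B Ii; rewrite defI in dI cI.
  exists f; split=> //; first by rewrite -(dim_stair Qu).
  exact/(nilpotence_class_stair Qu).
exists (stair_space Q f); split; first exact: stair_ideal.
  by rewrite dim_stair.
exact/(nilpotence_class_stair Qu).
Qed.

(** * Cartan and Borel subalgebras *)

Section SeqSum.
Variables (F : fieldType) (V : vectType F) (I : eqType).
Implicit Types (s : seq I) (U : I -> {vspace V}) (W : {vspace V}).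

Lemma sumv_seq_sup s U i : i \in s -> (U i <= \sum_(j <- s) U j)%VS.
Proof. by move=> si; rewrite (big_rem i si) addvSl. Qed.

Lemma sumv_seq_sub s U W : (forall i, i \in s -> (U i <= W)%VS) ->
  (\sum_(j <- s) U j <= W)%VS.
Proof.
move=> UW; rewrite big_seq; elim/big_rec: _ => [|i X si XW]; first exact: sub0v.
by rewrite subv_add UW.
Qed.
End SeqSum.

(** For an eigenvector [w] of [x], the products [w *m y] with [y] in [sl], together with [w], span
    all row vectors. Since [sl] is spanned by eigenvectors of [ad x], these products are sums of
    eigenvectors of [x]. *)
Lemma ad_semisimple_diagonalizable (F : numClosedFieldType) n (x : 'M[F]_n.+1) :
  ad_semisimple x -> diagonalizable x.
Proof.
case=> s sl_s; have [a /eigenvalueP[w wx w0]] := eigenvalue_closed x (ltn0Sn n).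
pose rs := undup (a :: [seq a - c | c <- s]).
apply/diagonalizablePeigen; exists rs; first exact: undup_uniq.
set T := (\sum_(r <- rs) _)%MS.
have subT r : r \in rs -> (eigenspace x r <= T)%MS.
  by move=> rs_r; rewrite /T (big_rem r rs_r) addsmxSl.
(* w [x, y] = a (w y) - (w y) x, so y |-> w y maps eigenvectors of ad x to
   eigenvectors of x. *)
have sl_T y : y \in sl F n -> (w *m y <= T)%MS.
  move/(subvP sl_s).
  have: {subset s <= s} by []; elim: {-2}s y => [|c t IHt] y ts.
    by rewrite big_nil memv0 => /eqP->; rewrite mulmx0 sub0mx.
  rewrite big_cons => /memv_addP[u /memv_capP[_ u_c] [v vt ->]].
  rewrite mulmxDr addmx_sub //; last by apply: IHt vt => d td; rewrite ts ?inE ?td ?orbT.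
  apply: submx_trans (subT (a - c) _); last first.
    rewrite mem_undup inE; apply/orP; right; apply/mapP; exists c => //.
    by rewrite ts ?mem_head.
  have {u_c}: lie x u = c *: u.
    by move: u_c; rewrite memv_ker !lfun_simp subr_eq0 => /eqP.
  move=> xu; apply/eigenspaceP.
  have: w *m (x *m u - u *m x) = w *m (c *: u) by rewrite -xu.
  rewrite mulmxBr !mulmxA wx -!scalemxAl -scalemxAr => /(canRL (subrK _)).
  by rewrite scalerBl => ->; rewrite addrC addKr.
have w_T : (w <= T)%MS.
  apply: submx_trans (subT a _); last by rewrite mem_undup mem_head.
  exact/eigenspaceP.
have [j wj] : exists j, w 0 j != 0 by apply/rV0Pn.
apply/eqmxP; rewrite submx1 /=; apply/row_subP => i.
set u := row i 1%:M.
pose y := (w 0 j)^-1 *: (delta_mx j 0 *m u).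
have -> : u = w *m y.
  rewrite /y -scalemxAr mulmxA -colE [col j w]mx11_scalar mul_scalar_mx scalerA.
  by rewrite mxE mulVf // scale1r.
(* The scalar part, which makes the rest traceless, sends [w] to a multiple of itself. *)
have -> : y = (y - (\tr y / n.+1%:R)%:M) + (\tr y / n.+1%:R)%:M by rewrite subrK.
rewrite mulmxDr addmx_sub ?mul_mx_scalar ?scalemx_sub //; apply: sl_T.
rewrite mem_sl linearB /= mxtrace_scalar -[X in _ - X]mulr_natr mulfVK ?subrr //.
by rewrite pnatr_eq0.
Qed.

Section Cartan.
Variables (F : numClosedFieldType) (n : nat) (h : {vspace 'M[F]_n.+1}).
Hypothesis h_cartan : cartan h.
Local Notation gl := 'M[F]_n.+1.

(** A basis of [h] consists of commuting diagonalizable matrices, hence is codiagonalizable. The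
    traceless diagonal matrices [k] in the resulting basis form an Abelian subspace containing [h],
    so maximality gives equality. *)
Lemma cartan_diag : exists2 P : gl, P \in unitmx & forall x,
  x \in h <-> \tr x = 0 /\ forall i j, i != j -> co P x i j = 0.
Proof.
have [sub_h ab_h max_h ss_h] := h_cartan.
have [|P Pu /allP diagP] := (codiagonalizableP (vbasis h)).1.
  split=> [x y /vbasis_mem hx /vbasis_mem hy|x /vbasis_mem /ss_h].
    by apply/eqP; rewrite -subr_eq0; apply/eqP; apply: ab_h.
  exact: ad_semisimple_diagonalizable.
exists P => //; pose U i := <[co_inv P (delta_mx i i)]>%VS.
pose k : {vspace gl} := ((\sum_i U i) :&: sl F n)%VS.
have memU x : reflect (forall i j, i != j -> co P x i j = 0) (x \in \sum_i U i)%VS.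
  apply: (iffP memv_sumP) => [[u uU ->] i j neq_ij|x0].
    rewrite linear_sum summxE big1 // => l _; have /vlineP[c ->] := uU l isT.
    rewrite linearZ /= co_invK // !mxE.
    case: (eqVneq i l) neq_ij => [->|_ _] /=; last by rewrite mulr0.
    by rewrite eq_sym => /negPf->; rewrite mulr0.
  exists (fun i => co P x i i *: co_inv P (delta_mx i i)) => [i _|].
    by rewrite rpredZ ?memv_line.
  rewrite {1}[x](sum_unit Pu).
  rewrite -(pair_bigA _ (fun i j => co P x i j *: co_inv P (delta_mx i j))) /=.
  apply: eq_bigr => i _; rewrite (bigD1 i) //= big1 ?addr0 // => j neq_ji.
  by rewrite x0 ?scale0r // eq_sym.
have memk x : reflect (\tr x = 0 /\ forall i j, i != j -> co P x i j = 0) (x \in k).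
  rewrite memv_cap mem_sl; apply: (iffP andP) => [[/memU x0 /eqP]|[trx /memU ->]] //.
  by rewrite trx.
suff -> : h = k by move=> x; split=> [/memk|[? ?]]; [|apply/memk].
apply/esym/max_h; first exact: capvSr.
  move=> x y /memk[_ x0] /memk[_ y0]; apply: (can_inj (coK Pu)).
  apply/matrixP => i j; rewrite co_lieE // linear0 mxE.
  rewrite (bigD1 i) // big1 /= => [|l]; last by rewrite eq_sym => /x0->; rewrite mul0r.
  rewrite (bigD1 i) // big1 /= => [|l]; last by rewrite eq_sym => /y0->; rewrite mul0r.
  rewrite !addr0; have [->|neq] := eqVneq i j; first by rewrite mulrC subrr.
  by rewrite (x0 i j) // (y0 i j) // !mulr0 subrr.
apply/subvP => x hx; apply/memk; split; first by apply/eqP; rewrite -mem_sl (subvP sub_h).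
rewrite (coord_vbasis hx) => i j neq_ij; rewrite linear_sum summxE big1 // => l _.
have: (vbasis h)`_l \in vbasis h by rewrite mem_nth ?size_tuple.
move=> /diagP; rewrite /= /similar_to conjumx // => /is_diag_mxP diagl.
by rewrite linearZ mxE /co diagl ?mulr0.
Qed.

(** * Roots and root spaces in the diagonalizing basis *)

Section Roots.
Variable P : gl.
Hypothesis P_unit : P \in unitmx.
Hypothesis mem_h : forall x,
  x \in h <-> \tr x = 0 /\ forall i j, i != j -> co P x i j = 0.
Local Notation E i j := (co_inv P (delta_mx i j)).
Implicit Types (a : dual h) (i j k : 'I_n.+1).

Definition weight_fun i j (H : subvs_of h) : F^o :=
  co P (vsval H) i i - co P (vsval H) j j.

Fact weight_fun_linear i j : linear (weight_fun i j).
Proof.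
move=> c H H'; rewrite /weight_fun !linearP !mxE scalerBr.
by rewrite opprD addrACA.
Qed.
HB.instance Definition _ i j := GRing.isLinear.Build F (subvs_of h) F^o *:%R
  (weight_fun i j) (weight_fun_linear i j).

Definition weight i j : dual h := linfun (weight_fun i j).

Lemma weightE i j H : weight i j H = co P (vsval H) i i - co P (vsval H) j j.
Proof. by rewrite lfunE. Qed.

Lemma weightD i j k : weight i j + weight j k = weight i k.
Proof. by apply/lfunP => H; rewrite add_lfunE !weightE addrA subrK. Qed.

Lemma weight_id i : weight i i = 0.
Proof. by apply/lfunP => H; rewrite zero_lfunE weightE subrr. Qed.

Lemma weightN i j : - weight i j = weight j i.
Proof. by apply/eqP; rewrite -subr_eq0 -opprD weightD weight_id oppr0. Qed.

Lemma co_lie_cartan (H : subvs_of h) x i j :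
  co P (lie (vsval H) x) i j = weight i j H * co P x i j.
Proof.
have [_ H0] := (mem_h _).1 (subvsP H).
rewrite co_lieE // weightE mulrBl.
rewrite (bigD1 i) // big1 /= => [|l]; last by rewrite eq_sym => /H0->; rewrite mul0r.
rewrite (bigD1 j) // big1 /= => [|l /H0->]; last by rewrite mulr0.
by rewrite !addr0 [X in _ - X]mulrC.
Qed.

Lemma root_space_unit i j : i != j -> E i j \in root_space (weight i j).
Proof.
move=> neq_ij; apply/root_spaceP; split=> [|H].
  rewrite mem_sl -(mxtrace_co P_unit) co_invK // /mxtrace big1 // => l _.
  by rewrite mxE; case: eqP => // ->; rewrite (negPf neq_ij).
apply: (can_inj (coK P_unit)); apply/matrixP => k l.
rewrite co_lie_cartan linearZ /= co_invK // !mxE.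
by case: eqP => [->|_]; case: eqP => [->|_] //; rewrite !mulr0.
Qed.

(** Comparing entries at [(i, j)] in the eigenvector equation and cancelling the nonzero one
    determines [a]. *)
Lemma root_space_weight a x i j : x \in root_space a -> co P x i j != 0 -> a = weight i j.
Proof.
move=> /root_spaceP[_ xa] xij; apply/lfunP => H.
have /(congr1 (co P))/matrixP/(_ i j) := xa H.
by rewrite co_lie_cartan linearZ [RHS]mxE => /esym; apply: (mulIf xij).
Qed.

Lemma is_root_weight i j : i != j -> is_root (weight i j).
Proof.
move=> neq_ij; apply/andP; split.
  have charF : n.+1%:R != 0 :> F by rewrite pnatr_eq0.
  (* On this element [weight i j] takes the value 1. *)
  have Hi : hdiag P i \in h.
    apply/mem_h; split=> [|k l /negPf neq_kl]; first exact: mxtrace_hdiag.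
    by rewrite co_invK // mxE neq_kl.
  apply/negP => /eqP/lfunP/(_ (Subvs Hi))/eqP.
  rewrite weightE lfunE /= co_invK // !mxE !eqxx [j == i]eq_sym (negPf neq_ij) /= !mulr1n.
  by rewrite opprB addrA subrK subr0 oner_eq0.
apply/negP => /eqP E0; have := root_space_unit neq_ij.
rewrite E0 memv0 => /eqP/(congr1 (co P))/matrixP/(_ i j)/eqP.
by rewrite co_invK // linear0 !mxE !eqxx oner_eq0.
Qed.

(** * The total order on indices given by a positive system *)

Variable D : seq (dual h).
Hypothesis D_pos : positive_system D.

Lemma pos_weight_irr i : weight i i \notin D.
Proof.
by apply/negP => /(possys_root D_pos); rewrite /is_root weight_id eqxx.
Qed.

Lemma pos_weight_opp i j : i != j -> (weight j i \in D) = (weight i j \notin D).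
Proof.
by move=> neq_ij; rewrite (possys_opp D_pos) ?is_root_weight 1?eq_sym // weightN.
Qed.

Lemma pos_weight_trans i j k :
  weight i j \in D -> weight j k \in D -> weight i k \in D.
Proof.
move=> ij jk; have neq_ij : i != j by apply: contraTneq ij => ->; apply: pos_weight_irr.
have [eq_ik|neq_ik] := eqVneq i k.
  by move: jk; rewrite -eq_ik pos_weight_opp // ij.
by rewrite -(weightD i j k) (possys_add D_pos) // weightD is_root_weight.
Qed.

(** The position of [k] when [i] precedes [k] iff [weight i k] is positive. *)
Definition pos_rank k := #|[set i | weight i k \in D]|.

Lemma pos_rank_lt k l : weight k l \in D -> (pos_rank k < pos_rank l)%N.
Proof.
move=> kl; apply/proper_card/properP; split.
  by apply/subsetP => i; rewrite !inE => ik; apply: pos_weight_trans ik kl.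
by exists k; rewrite !inE ?pos_weight_irr.
Qed.

Lemma pos_rank_ord k : (pos_rank k < n.+1)%N.
Proof.
rewrite -[ltnRHS]card_ord -cardsT; apply/proper_card/properP; split=> //.
by exists k; rewrite !inE ?pos_weight_irr.
Qed.

Lemma pos_rank_inj : injective (fun k => Ordinal (pos_rank_ord k)).
Proof.
move=> k l [] eq_kl; apply/eqP; apply: contraT => neq_kl.
have [kl|] := boolP (weight k l \in D).
  by have := pos_rank_lt kl; rewrite eq_kl ltnn.
by rewrite -pos_weight_opp // => /pos_rank_lt; rewrite eq_kl ltnn.
Qed.

(** The rows of [P] are sorted by rank. For [id] the stair space consists of all upper triangular
    matrices, diagonal included. *)
Lemma borel_stair : exists2 Q : gl, Q \in unitmx &
  borel D = (stair_space Q id :&: sl F n)%VS.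
Proof.
pose s := perm pos_rank_inj; pose t := (s^-1)%g; pose Q := perm_mx t *m P.
have Qu : Q \in unitmx by rewrite unitmx_mul unitmx_perm.
have coQ x i j : co Q x i j = co P x (t i) (t j).
  have -> : co Q x = perm_mx t *m co P x *m perm_mx t^-1.
    have -> : co Q x = Q *m x *m (invmx P *m perm_mx t^-1).
      by congr (_ *m _); rewrite perm_mxV; apply: invrM; rewrite ?unitmx_perm.
    by rewrite /co /Q !mulmxA.
  by rewrite -row_permE -col_permE !mxE.
have t_rank i : pos_rank (t i) = i.
  by have := congr1 val (permKV s i); rewrite permE.
have rank_t i j : weight (t i) (t j) \in D -> (i < j)%N.
  by move/pos_rank_lt; rewrite !t_rank.
exists Q => //; apply/eqP; rewrite eqEsubv; apply/andP; split.
  rewrite subv_add; apply/andP; split.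
    apply/subvP => x /mem_h[trx x0]; rewrite memv_cap mem_sl trx eqxx andbT.
    apply/mem_stair => // i j lt_ji; rewrite coQ x0 //.
    by rewrite (inj_eq perm_inj) -val_eqE neq_ltn lt_ji orbT.
  apply: sumv_seq_sub => r Dr; apply/subvP => x x_r; rewrite memv_cap.
  have [-> _] := root_spaceP _ _ x_r; rewrite andbT.
  apply/mem_stair => // i j lt_ji; rewrite coQ; apply/eqP; apply: contraTT lt_ji.
  by move=> /(root_space_weight x_r) defr; rewrite -leqNgt ltnW // rank_t // -defr.
apply/subvP => x; rewrite memv_cap mem_sl => /andP[/(mem_stair Qu) x0 /eqP trx].
have x0' i j : i != j -> weight i j \notin D -> co P x i j = 0.
  move=> neq_ij; rewrite -pos_weight_opp // => ji.
  have ts k : t (s k) = k by apply: permK.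
  by have := coQ x (s i) (s j); rewrite !ts => <-; rewrite x0 // rank_t // !ts.
(* The off-diagonal part [z] lies in the positive root spaces. It is traceless, so the diagonal part
   [y] is too and lies in [h]. *)
have := sum_unit P_unit x; rewrite (bigID (fun p => p.1 == p.2)) /=.
set y := \sum_(_ | _ == _) _; set z := \sum_(_ | _) _ => defx.
have zD : z \in (\sum_(r <- D) root_space r)%VS.
  apply: rpred_sum => -[k l] /= neq_kl.
  have [Dkl|/(x0' _ _ neq_kl)->] := boolP (weight k l \in D); last first.
    by rewrite scale0r mem0v.
  by rewrite rpredZ //; apply/(subvP (sumv_seq_sup _ Dkl))/root_space_unit.
rewrite defx memv_add //; apply/mem_h; split=> [|i j neq_ij].
  have : z \in sl F n.
    apply: subvP zD; apply: sumv_seq_sub => r _; apply/subvP => u.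
    by case/root_spaceP.
  by rewrite mem_sl => /eqP trz; move: trx; rewrite defx linearD /= trz addr0.
rewrite linear_sum summxE big1 // => -[k l] /= /eqP <-.
rewrite linearZ /= co_invK // !mxE.
case: (eqVneq i k) neq_ij => [->|_ _] /=; last by rewrite mulr0.
by rewrite eq_sym => /negPf->; rewrite mulr0.
Qed.
End Roots.
End Cartan.

Lemma borel_classes (F : numClosedFieldType) n (h : {vspace 'M[F]_n.+1})
    (D : seq (dual h)) A c : cartan h -> positive_system D ->
  classes_of_dim (borel D) A c <-> staircase_class n A c.
Proof.
move=> h_cartan D_pos; have [P Pu mem_h] := cartan_diag h_cartan.
have [Q Qu ->] := borel_stair Pu mem_h D_pos.
apply: (classes_of_dim_staircase _ _ Qu); first by rewrite pnatr_eq0.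
move=> x; rewrite memv_cap mem_sl; apply: (iffP andP).
  by case=> /(mem_stair Qu) x0 /eqP.
by case=> -> x0; split=> //; apply/mem_stair.
Qed.

Theorem theorem6p3 (R : realType) (n : nat) (n_ge1 : (1 <= n)%N)
    (h : {vspace 'M[R[i]]_n.+1}) (h_cartan : cartan h)
    (D : seq (dual h)) (D_pos : positive_system D)
    (A : nat) (A_le : (A <= 'C(n.+1, 2))%N) :
  (exists k : nat,
      is_least (classes_of_dim (borel D) A) k
      /\ is_least (fun j => A%:Z <= min_bound n j) k)
  /\
  (exists k : nat,
      is_greatest (classes_of_dim (borel D) A) k
      /\ k%:Z = Num.floor (n%:R + 3%:R / 2%:R
           - 2%:R^-1 * Num.sqrt (4%:R * n%:R ^+ 2 + 4%:R * n%:R + 9%:R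
                                 - 8%:R * A%:R) : R)).
Proof.
have classE c := borel_classes A c h_cartan D_pos; split.
  have [k [[kP k_min] min_k]] := least_staircase_class A_le.
  by exists k; split=> //; split=> [|j /classE/k_min//]; apply/classE.
have [k [[kP k_max] le_kn lo hi]] := greatest_staircase_class A_le.
exists k; split; last exact: floor_class.
by split=> [|j /classE/k_max//]; apply/classE.
Qed.
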